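(* Let $X$ be a finite graph (multiple edges and loops allowed) in which every vertex has positive degree, and let $P$ be a transmission system on $X$ with ranks $n(v)$. Let $\lambda\in\mathbb{C}$ be an eigenvalue of the transmission graph Laplacian $\Delta^P$. Then $$|\Re(\lambda)-1|\le|\lambda-1|\le \max_{\vec e\in E^+(X)}\|P(\vec e)\|,\qquad \Im(\lambda)\le \tfrac12\max_{\vec e\in E^+(X)}\|P(\vec e)^\star-P(op(\vec e))\|.$$ In particular, if $P$ is (Hermitian) symmetric then $\Delta^P$ is self-adjoint and has real eigenvalues; and if $P$ is strictly unitary, then all eigenvalues of $\Delta^P$ are real and lie in the interval $[0,2]$.
   Context: Graph conventions: $V(X)$ is the vertex set; each undirected edge gives two directed edges (a loop at $v$ gives two directed edges from $v$ to $v$); $E^+(X)$ is the set of directed edges. For $\vec e\in E^+(X)$, $i(\vec e)$ is its initial point, $t(\vec e)$ its terminal point, and $op(\vec e)$ the same edge with reversed direction. The degree is $d_w=\#\{\vec e\in E^+(X): t(\vec e)=w\}$. A transmission system $P$ assigns to each vertex $v$ a nonnegative integer $n(v)$ and to each directed edge $\vec e$ a complex $n(t(\vec e))\times n(i(\vec e))$ matrix $P(\vec e)$. The $0$-cochains are $C^0=\bigoplus_{v\in V(X)}\mathbb{C}^{n(v)}$ (functions $f$ with $f(v)\in\mathbb{C}^{n(v)}$), with Hermitian inner product $\langle f,g\rangle=\sum_v\langle f(v),g(v)\rangle$. The transmission graph Laplacian is the linear operator on $C^0$ $$(\Delta^P f)(w)=f(w)-\sum_{\vec e:\ t(\vec e)=w}\frac{1}{\sqrt{d_w\,d_{i(\vec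 e)}}}\,P(\vec e)\,f(i(\vec e)).$$ $P$ is (Hermitian) symmetric if $P(op(\vec e))=P(\vec e)^\star$ for all $\vec e$; invertible if $P(op(\vec e))=P(\vec e)^{-1}$ for all $\vec e$ (so the matrices are square); strictly unitary if both hold (so every $P(\vec e)$ is unitary). $\|\cdot\|$ denotes the operator norm. *)

(* Defs.v *)
From HB Require Import structures.
From mathcomp Require Import all_boot all_order all_algebra.
From mathcomp Require Import classical_sets reals.
From mathcomp Require Export complex.

Set Implicit Arguments.
Unset Strict Implicit.
Unset Printing Implicit Defensive.

Import Order.TTheory GRing.Theory Num.Theory.

Local Open Scope ring_scope.
Local Open Scope complex_scope.
Local Open Scope sesquilinear_scope.

(* A finite graph, multiple edges and loops allowed, presented by its directed
   edges.  An undirected edge is an orbit {e, op e}; as op has no fixed point,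
   every edge (a loop included) consists of exactly two directed edges. *)
Record graph := Graph {
  vertex : finType;
  dart : finType;
  ini : dart -> vertex;
  ter : dart -> vertex;
  op : dart -> dart;
  op_involutive : involutive op;
  op_neq : forall e, op e != e;
  ini_op : forall e, ini (op e) = ter e
}.

Lemma ter_op (X : graph) (e : dart X) : ter (op e) = ini e.
Proof. by rewrite -ini_op op_involutive. Qed.

Definition deg (X : graph) (w : vertex X) : nat :=
  #|[set e : dart X | ter e == w]|.

Record transmission (R : realType) (X : graph) := Transmission {
  rank : vertex X -> nat;
  trmat :> forall e : dart X, 'M[R[i]]_(rank (ter e), rank (ini e))
}.

Section Cochains.
Variables (R : realType) (X : graph) (P : transmission R X).

Definition cochain : Type := {dffun forall v : vertex X, 'cV[R[i]]_(rank P v)}.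
HB.instance Definition _ := Choice.on cochain.

Implicit Types (f g : cochain) (a : R[i]).

Definition cochain_zero : cochain := [ffun v => 0].
Definition cochain_opp f : cochain := [ffun v => - f v].
Definition cochain_add f g : cochain := [ffun v => f v + g v].
Definition cochain_scale a f : cochain := [ffun v => a *: f v].

Fact cochain_addA : associative cochain_add.
Proof. by move=> f g h; apply/ffunP => v; rewrite !ffunE addrA. Qed.
Fact cochain_addC : commutative cochain_add.
Proof. by move=> f g; apply/ffunP => v; rewrite !ffunE addrC. Qed.
Fact cochain_add0 : left_id cochain_zero cochain_add.
Proof. by move=> f; apply/ffunP => v; rewrite !ffunE add0r. Qed.
Fact cochain_addN : left_inverse cochain_zero cochain_opp cochain_add.
Proof. by move=> f; apply/ffunP => v; rewrite !ffunE addNr. Qed.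

HB.instance Definition _ := GRing.isZmodule.Build cochain
  cochain_addA cochain_addC cochain_add0 cochain_addN.

Fact cochain_scaleA a b f :
  cochain_scale a (cochain_scale b f) = cochain_scale (a * b) f.
Proof. by apply/ffunP => v; rewrite !ffunE scalerA. Qed.
Fact cochain_scale1 : left_id 1 cochain_scale.
Proof. by move=> f; apply/ffunP => v; rewrite !ffunE scale1r. Qed.
Fact cochain_scaleDr : right_distributive cochain_scale +%R.
Proof. by move=> a f g; apply/ffunP => v; rewrite !ffunE scalerDr. Qed.
Fact cochain_scaleDl f : {morph cochain_scale^~ f : a b / a + b}.
Proof. by move=> a b; apply/ffunP => v; rewrite !ffunE scalerDl. Qed.

HB.instance Definition _ := GRing.Zmodule_isLmodule.Build R[i] cochain
  cochain_scaleA cochain_scale1 cochain_scaleDr cochain_scaleDl.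

End Cochains.

Definition cvdot (R : realType) (n : nat) (u v : 'cV[R[i]]_n) : R[i] :=
  dotmx u^T v^T.

Definition cvnorm (R : realType) (n : nat) (u : 'cV[R[i]]_n) : R :=
  Num.sqrt (complex.Re (cvdot u u)).

Definition opnorm (R : realType) (m n : nat) (A : 'M[R[i]]_(m, n)) : R :=
  sup [set cvnorm (A *m u) | u in [set u : 'cV[R[i]]_n | cvnorm u <= 1]]%classic.

Definition cochain_dot (R : realType) (X : graph) (P : transmission R X)
    (f g : cochain P) : R[i] :=
  \sum_(v : vertex X) cvdot (f v) (g v).

(* P(op e), with its dimensions rewritten along the endpoints of op e. *)
Definition optrmat (R : realType) (X : graph) (P : transmission R X)
    (e : dart X) : 'M[R[i]]_(rank P (ini e), rank P (ter e)) :=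
  castmx (congr1 (rank P) (ter_op e), congr1 (rank P) (ini_op e)) (P (op e)).

(* P(e) f(i(e)) lives in the fibre over ter e, which is the fibre over w for
   every e in the sum, so conform_mx only casts and its default is not used. *)
Definition laplacian (R : realType) (X : graph) (P : transmission R X)
    (f : cochain P) : cochain P :=
  [ffun w => f w - \sum_(e : dart X | ter e == w)
     ((Num.sqrt ((deg w)%:R * (deg (ini e))%:R))^-1)%:C *:
       conform_mx 0 (P e *m f (ini e))].

Section LaplacianLinear.
Variables (R : realType) (X : graph) (P : transmission R X).

Fact laplacian_is_linear : linear (@laplacian R X P).
Proof.
move=> a f g; apply/ffunP => w; rewrite !ffunE.
rewrite scalerBr addrACA -opprD scaler_sumr -big_split /=; congr (_ - _).
apply: eq_bigr => e /eqP <-; rewrite !conform_mx_id !ffunE mulmxDr -scalemxAr.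
by rewrite scalerDr !scalerA mulrC.
Qed.

HB.instance Definition _ := GRing.isLinear.Build R[i] (cochain P) (cochain P)
  *:%R (@laplacian R X P) laplacian_is_linear.

End LaplacianLinear.

Definition is_eigenvalue (R : realType) (X : graph) (P : transmission R X)
    (T : cochain P -> cochain P) (lambda : R[i]) : Prop :=
  exists2 f : cochain P, f != 0 & T f = lambda *: f.

Definition self_adjoint (R : realType) (X : graph) (P : transmission R X)
    (T : cochain P -> cochain P) : Prop :=
  forall f g : cochain P, cochain_dot (T f) g = cochain_dot f (T g).

Definition symmetric_transmission (R : realType) (X : graph)
    (P : transmission R X) : Prop :=
  forall e : dart X, optrmat P e = (P e) ^t*.

(* P(op e) = P(e)^-1 as a two-sided inverse; this forces P(e) to be square. *)
Definition invertible_transmission (R : realType) (X : graph)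
    (P : transmission R X) : Prop :=
  forall e : dart X,
    P e *m optrmat P e = 1%:M /\ optrmat P e *m P e = 1%:M.

Definition strictly_unitary (R : realType) (X : graph)
    (P : transmission R X) : Prop :=
  symmetric_transmission P /\ invertible_transmission P.

(* Main.v *)
(* For an eigenvector [f], pairing [laplacian f = lambda *: f] with [f] turns
   [1 - lambda] into the sum over darts of [cvdot (P e *m f (ini e)) (f (ter e))]
   divided by [sqrt (d_ter d_ini)], relative to the squared norm of [f].
   Comparing [<laplacian f, f>] with [<f, laplacian f>] after reversing every
   dart expresses [2 'i Im lambda] by the same sum for [P(e)^* - P(op e)].
   Both sums are at most the largest operator norm times the squared norm of
   [f]. *)
Require Import Defs.
From mathcomp Require Import all_boot all_order all_algebra.
From mathcomp Require Import reals.

Set Implicit Arguments.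
Unset Strict Implicit.
Unset Printing Implicit Defensive.

Import Order.TTheory GRing.Theory Num.Theory.

Local Open Scope ring_scope.
Local Open Scope complex_scope.
Local Open Scope sesquilinear_scope.

Lemma dotmx_CauchySchwarz (C : numClosedFieldType) n (u v : 'rV[C]_n) :
  `|dotmx u v| ^+ 2 <= dotmx u u * dotmx v v.
Proof. by have [] := CauchySchwarz (@dotmx C n) u v. Qed.

(** * Hermitian norm of column vectors and the operator norm of matrices *)

Section ColumnVectors.
Variable R : realType.
Implicit Types m n : nat.

Lemma real_complexX (x : R) k : (x ^+ k)%:C = x%:C ^+ k.
Proof. exact: rmorphXn. Qed.

Lemma real_complexM (x y : R) : (x * y)%:C = x%:C * y%:C.
Proof. exact: rmorphM. Qed.

Lemma cvdotE n (u v : 'cV[R[i]]_n) :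
  cvdot u v = \sum_k u k 0 * Num.conj (v k 0).
Proof.
rewrite /cvdot dotmxE mxE; apply: eq_bigr => k _.
by rewrite !mxE.
Qed.

Lemma cvdotC n (u v : 'cV[R[i]]_n) : cvdot v u = Num.conj (cvdot u v).
Proof.
rewrite !cvdotE rmorph_sum; apply: eq_bigr => k _.
by rewrite rmorphM /= conjCK mulrC.
Qed.

Lemma cvdotBl n (u v w : 'cV[R[i]]_n) :
  cvdot (u - v) w = cvdot u w - cvdot v w.
Proof.
rewrite !cvdotE -sumrB; apply: eq_bigr => k _.
by rewrite !mxE mulrBl.
Qed.

Lemma cvdotZl n a (u v : 'cV[R[i]]_n) : cvdot (a *: u) v = a * cvdot u v.
Proof.
rewrite !cvdotE mulr_sumr; apply: eq_bigr => k _.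
by rewrite !mxE mulrA.
Qed.

Lemma cvdot_suml n (I : finType) (Q : pred I) (F : I -> 'cV[R[i]]_n) v :
  cvdot (\sum_(i | Q i) F i) v = \sum_(i | Q i) cvdot (F i) v.
Proof.
rewrite cvdotE; under eq_bigr do rewrite summxE mulr_suml.
by rewrite exchange_big /=; apply: eq_bigr => i _; rewrite cvdotE.
Qed.

Lemma cvdot_adj m n (A : 'M[R[i]]_(m, n)) u v :
  cvdot u (A *m v) = cvdot (A^t* *m u) v.
Proof.
rewrite !cvdotE.
under eq_bigr do rewrite mxE rmorph_sum mulr_sumr.
rewrite exchange_big; apply: eq_bigr => j _.
rewrite mxE mulr_suml; apply: eq_bigr => i _.
by rewrite !mxE rmorphM mulrA [_ * u i 0]mulrC.
Qed.

Lemma cvdot_self n (u : 'cV[R[i]]_n) : cvdot u u = \sum_k `|u k 0| ^+ 2.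
Proof. by rewrite cvdotE; apply: eq_bigr => k _; rewrite normCK. Qed.

Lemma cvdot_self_ge0 n (u : 'cV[R[i]]_n) : 0 <= cvdot u u.
Proof. by rewrite cvdot_self sumr_ge0// => k _; rewrite exprn_ge0. Qed.

Lemma cvnorm_ge0 n (u : 'cV[R[i]]_n) : 0 <= cvnorm u.
Proof. exact: sqrtr_ge0. Qed.

(** [cvnorm] keeps only the real part of [cvdot u u]; nothing is lost, since a sum of squared moduli
    is real and nonnegative. *)
Lemma cvnorm_sqr n (u : 'cV[R[i]]_n) : (cvnorm u ^+ 2)%:C = cvdot u u.
Proof.
have u0 := cvdot_self_ge0 u.
rewrite sqr_sqrtr ?RRe_real ?ger0_real//.
by rewrite -ler0c RRe_real ?ger0_real.
Qed.

Lemma cvnorm0 n : cvnorm (0 : 'cV[R[i]]_n) = 0.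
Proof.
by rewrite /cvnorm cvdot_self big1 ?sqrtr0// => k _; rewrite mxE normr0 expr0n.
Qed.

Lemma cvnorm_eq0 n (u : 'cV[R[i]]_n) : cvnorm u = 0 -> u = 0.
Proof.
move=> u0; have /esym := cvnorm_sqr u; rewrite u0 expr0n /= cvdot_self.
move=> /psumr_eq0P/= h; apply/matrixP => k j; rewrite (ord1 j) mxE.
by apply/eqP; rewrite -normr_eq0 -sqrf_eq0 h// => i _; rewrite exprn_ge0.
Qed.

Lemma cvnormZ n (c : R) (u : 'cV[R[i]]_n) :
  0 <= c -> cvnorm (c%:C *: u) = c * cvnorm u.
Proof.
move=> c0; apply/eqP; rewrite -(eqrXn2 (n := 2))//; last 2 first.
- exact: cvnorm_ge0.
- by rewrite mulr_ge0 ?cvnorm_ge0.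
rewrite -(inj_eq (@complexI R)) cvnorm_sqr exprMn rmorphM/= cvnorm_sqr.
rewrite cvdotZl cvdotC cvdotZl rmorphM /= -cvdotC mulrA -normCK normc_def/=.
by rewrite expr0n addr0 sqrtr_sqr ger0_norm// rmorphXn.
Qed.

Lemma cvdot_le n (u v : 'cV[R[i]]_n) :
  `|cvdot u v| <= (cvnorm u * cvnorm v)%:C.
Proof.
rewrite -(@ler_pXn2r _ 2 isT) ?nnegrE ?normr_ge0 ?ler0c ?mulr_ge0 ?cvnorm_ge0//.
have -> : (cvnorm u * cvnorm v)%:C ^+ 2 = cvdot u u * cvdot v v.
  by rewrite -!cvnorm_sqr -real_complexX exprMn real_complexM.
exact: dotmx_CauchySchwarz.
Qed.

(** The Frobenius norm serves as [K], by Cauchy-Schwarz on each row. Its role is to bound the set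
    whose supremum is [opnorm A]. *)
Lemma cvnorm_mulmx_bound m n (A : 'M[R[i]]_(m, n)) :
  {K : R | 0 <= K & forall u, cvnorm (A *m u) <= K * cvnorm u}.
Proof.
pose c i := cvnorm ((row i A)^t*).
have c0 : 0 <= \sum_i c i ^+ 2.
  by rewrite sumr_ge0// => i _; rewrite exprn_ge0 ?cvnorm_ge0.
exists (Num.sqrt (\sum_i c i ^+ 2)); first exact: sqrtr_ge0.
move=> u; rewrite -(@ler_pXn2r _ 2)// ?nnegrE ?mulr_ge0 ?sqrtr_ge0 ?cvnorm_ge0//.
rewrite -lecR cvnorm_sqr exprMn sqr_sqrtr// cvdot_self mulr_suml.
rewrite (rmorph_sum (real_complex R)).
apply: ler_sum => i _.
have -> : (A *m u) i 0 = cvdot u ((row i A)^t*).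
  rewrite cvdotE mxE; apply: eq_bigr => k _.
  by rewrite !mxE conjCK mulrC.
rewrite -exprMn rmorphXn lerXn2r ?nnegrE ?normr_ge0 ?ler0c ?mulr_ge0 ?cvnorm_ge0//.
by rewrite mulrC cvdot_le.
Qed.

Lemma cvnorm_mulmx_le m n (A : 'M[R[i]]_(m, n)) u :
  cvnorm (A *m u) <= opnorm A * cvnorm u.
Proof.
have [/cvnorm_eq0 ->|u0] := eqVneq (cvnorm u) 0.
  by rewrite mulmx0 !cvnorm0 mulr0.
have u_gt0 : 0 < cvnorm u by rewrite lt_def u0 cvnorm_ge0.
rewrite -ler_pdivrMr// mulrC.
rewrite -cvnormZ ?invr_ge0 ?cvnorm_ge0// scalemxAr.
(* The quotient [cvnorm (A *m u) / cvnorm u] is the value at the normalized vector, hence a member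
   of the set defining [opnorm A]. *)
apply: sup_upper_bound; last first.
  exists ((cvnorm u)^-1%:C *: u) => //=.
  by rewrite cvnormZ ?invr_ge0 ?cvnorm_ge0// mulVf.
split.
  by exists (cvnorm (A *m 0)); exists 0 => //=; rewrite cvnorm0.
have [K K0 AK] := cvnorm_mulmx_bound A.
exists K => _ [v /= v1 <-]; apply: le_trans (AK v) _.
by rewrite ler_piMr.
Qed.

Lemma opnorm_le m n (A : 'M[R[i]]_(m, n)) (K : R) :
  0 <= K -> (forall u, cvnorm (A *m u) <= K * cvnorm u) -> opnorm A <= K.
Proof.
move=> K0 AK; apply: ge_sup.
  by exists (cvnorm (A *m 0)); exists 0 => //=; rewrite cvnorm0.
move=> _ [v /= v1 <-]; apply: le_trans (AK v) _.
by rewrite ler_piMr.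
Qed.

Lemma cvdot_mulmx_le m n (A : 'M[R[i]]_(m, n)) u v :
  `|cvdot (A *m u) v| <= (opnorm A * (cvnorm u * cvnorm v))%:C.
Proof.
apply: le_trans (cvdot_le _ _) _.
by rewrite lecR mulrA ler_wpM2r ?cvnorm_ge0 ?cvnorm_mulmx_le.
Qed.

End ColumnVectors.

(** * Pairings of the Laplacian with cochains as sums over darts *)

Section Laplacian.
Variables (R : realType) (X : graph) (P : transmission R X).
Implicit Types (f g : cochain P) (e : dart X).

Definition dart_weight e : R :=
  (Num.sqrt ((deg (ter e))%:R * (deg (ini e))%:R))^-1.

Lemma dart_weight_ge0 e : 0 <= dart_weight e.
Proof. by rewrite invr_ge0 sqrtr_ge0. Qed.

Lemma dart_weight_op e : dart_weight (op e) = dart_weight e.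
Proof. by rewrite /dart_weight ter_op ini_op mulrC. Qed.

(** The vertices are arbitrary so that both equations can be eliminated; for [ter_op] and [ini_op]
    the endpoints are not variables. *)
Lemma cvdot_castmx f g (v v' w w' : vertex X) (eq_v : v = v') (eq_w : w = w')
    (A : 'M[R[i]]_(rank P v, rank P w)) :
  cvdot (castmx (congr1 (rank P) eq_v, congr1 (rank P) eq_w) A *m f w') (g v') =
  cvdot (A *m f w) (g v).
Proof. by case: _ / eq_v; case: _ / eq_w; rewrite castmx_id. Qed.

Lemma cochain_dotC f g : cochain_dot g f = Num.conj (cochain_dot f g).
Proof. by rewrite rmorph_sum; apply: eq_bigr => v _; rewrite cvdotC. Qed.

Lemma cochain_dotZl a f g : cochain_dot (a *: f) g = a * cochain_dot f g.
Proof.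
by rewrite mulr_sumr; apply: eq_bigr => v _; rewrite ffunE cvdotZl.
Qed.

Definition cochain_sqnorm f : R := \sum_v cvnorm (f v) ^+ 2.

Lemma cochain_dot_self f : cochain_dot f f = (cochain_sqnorm f)%:C.
Proof.
rewrite (rmorph_sum (real_complex R)).
by apply: eq_bigr => v _; rewrite -cvnorm_sqr.
Qed.

Lemma cochain_sqnorm_gt0 f : f != 0 -> 0 < cochain_sqnorm f.
Proof.
move=> f0; have sq_ge0 v : 0 <= cvnorm (f v) ^+ 2.
  by rewrite exprn_ge0 ?cvnorm_ge0.
rewrite lt_def sumr_ge0// andbT; apply: contra f0 => /eqP/psumr_eq0P h.
apply/eqP/ffunP => v; rewrite [RHS]ffunE; apply: cvnorm_eq0; apply/eqP.
by rewrite -sqrf_eq0 h.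
Qed.

(** Darts are grouped by terminal vertex; once [v] is replaced by [ter e], the [conform_mx] is the
    identity. *)
Lemma laplacian_dotl f g :
  cochain_dot (laplacian f) g = cochain_dot f g -
    \sum_e (dart_weight e)%:C * cvdot (P e *m f (ini e)) (g (ter e)).
Proof.
rewrite [in RHS](partition_big (@ter X) xpredT)//= -sumrB.
apply: eq_bigr => v _; rewrite ffunE cvdotBl cvdot_suml; congr (_ - _).
by apply: eq_bigr => e /eqP <-; rewrite cvdotZl conform_mx_id.
Qed.

Lemma laplacian_dotl_op f g :
  cochain_dot (laplacian f) g = cochain_dot f g -
    \sum_e (dart_weight e)%:C * cvdot (optrmat P e *m f (ter e)) (g (ini e)).
Proof.
rewrite laplacian_dotl; congr (_ - _).
rewrite (reindex_inj (inv_inj (@op_involutive X))).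
by apply: eq_bigr => e _; rewrite dart_weight_op cvdot_castmx.
Qed.

(** This is the conjugate of [laplacian_dotl] with [f] and [g] exchanged; the dart weights are real,
    so conjugation fixes them. *)
Lemma laplacian_dotr f g :
  cochain_dot f (laplacian g) = cochain_dot f g -
    \sum_e (dart_weight e)%:C * cvdot ((P e)^t* *m f (ter e)) (g (ini e)).
Proof.
rewrite cochain_dotC laplacian_dotl rmorphB /= -cochain_dotC; congr (_ - _).
rewrite rmorph_sum; apply: eq_bigr => e _.
rewrite rmorphM /= -cvdotC cvdot_adj; congr (_ * _).
by apply: CrealP; apply/complex_realP; exists (dart_weight e).
Qed.

Lemma laplacian_dotB f g :
  cochain_dot (laplacian f) g - cochain_dot f (laplacian g) =
    \sum_e (dart_weight e)%:C *
      cvdot (((P e)^t* - optrmat P e) *m f (ter e)) (g (ini e)).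
Proof.
rewrite laplacian_dotl_op laplacian_dotr opprB addrC addrA subrK -sumrB.
by apply: eq_bigr => e _; rewrite mulmxBl cvdotBl mulrBr.
Qed.

(** * Degree-weighted sums over darts and the eigenvalue bounds *)

Hypothesis deg_gt0 : forall v : vertex X, (0 < deg v)%N.

Lemma sum_ter_div_deg (s : vertex X -> R) :
  \sum_e s (ter e) / (deg (ter e))%:R = \sum_v s v.
Proof.
rewrite (partition_big (@ter X) xpredT)//=; apply: eq_bigr => v _.
rewrite (eq_bigr (fun=> s v / (deg v)%:R)) => [|e /eqP ->//].
by rewrite -big_set sumr_const -[LHS]mulr_natr divfK// pnatr_eq0 -lt0n.
Qed.

(** [deg] counts darts by terminal point; reversing every dart carries that count over to initial
    points. *)
Lemma sum_ini_div_deg (s : vertex X -> R) :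
  \sum_e s (ini e) / (deg (ini e))%:R = \sum_v s v.
Proof.
rewrite (reindex_inj (inv_inj (@op_involutive X))) -sum_ter_div_deg.
by apply: eq_bigr => e _; rewrite ini_op.
Qed.

(** This is [2ab <= a^2 + b^2] for [a = x / q] and [b = y / p], where [q] and [p] are the square
    roots of the degrees of [ini e] and [ter e]. *)
Lemma dart_weight_mul_le e (x y : R) :
  dart_weight e * (x * y) <=
    2^-1 * (x ^+ 2 / (deg (ini e))%:R + y ^+ 2 / (deg (ter e))%:R).
Proof.
rewrite /dart_weight sqrtrM ?ler0n//.
rewrite -{2}(sqr_sqrtr (ler0n R (deg (ini e)))).
rewrite -{2}(sqr_sqrtr (ler0n R (deg (ter e)))).
set p := Num.sqrt (deg (ter e))%:R; set q := Num.sqrt (deg (ini e))%:R.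
rewrite -!expr_div_n invfM.
have -> : p^-1 * q^-1 * (x * y) = (x / q) * (y / p).
  by rewrite [p^-1 * _]mulrC [LHS]mulrC mulrACA.
rewrite [leRHS]mulrC ler_pdivlMr ?ltr0n// -subr_ge0.
have -> : (x / q) ^+ 2 + (y / p) ^+ 2 - x / q * (y / p) * 2 =
  (x / q - y / p) ^+ 2 by rewrite sqrrB mulr_natr addrAC.
exact: sqr_ge0.
Qed.

(* AM-GM splits each dart term into [cvnorm (f v) ^+ 2 / deg v] at its two
   ends, and each vertex [v] is the end of [deg v] darts on either side. *)
Lemma dart_sum_le f (B : dart X -> R[i]) (M : R) : 0 <= M ->
    (forall e, `|B e| <= (M * (cvnorm (f (ini e)) * cvnorm (f (ter e))))%:C) ->
  `|\sum_e (dart_weight e)%:C * B e| <= (M * cochain_sqnorm f)%:C.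
Proof.
move=> M0 BM.
pose h e := 2^-1 * (cvnorm (f (ini e)) ^+ 2 / (deg (ini e))%:R +
                    cvnorm (f (ter e)) ^+ 2 / (deg (ter e))%:R).
have -> : cochain_sqnorm f = \sum_e h e.
  rewrite -mulr_sumr big_split /= (sum_ter_div_deg (fun v => cvnorm (f v) ^+ 2)).
  rewrite (sum_ini_div_deg (fun v => cvnorm (f v) ^+ 2)).
  by rewrite -mulr2n -[X in _ * X]mulr_natl mulKf ?pnatr_eq0.
rewrite mulr_sumr (rmorph_sum (real_complex R)).
apply: le_trans (ler_norm_sum _ _ _) _; apply: ler_sum => e _.
rewrite normrM ger0_norm ?ler0c ?dart_weight_ge0//.
apply: le_trans (ler_wpM2l _ (BM e)) _; first by rewrite ler0c dart_weight_ge0.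
rewrite -real_complexM lecR mulrCA ler_wpM2l//.
exact: dart_weight_mul_le.
Qed.

(** The bound [M] is left free: the maximum of the norms gives the general estimate, and [M = 1] the
    unitary case. *)
Lemma eigenvalue_sub1_le lambda (M : R) : 0 <= M ->
    (forall e, opnorm (P e) <= M) ->
  is_eigenvalue (@laplacian R X P) lambda -> `|lambda - 1| <= M%:C.
Proof.
move=> M0 PM [f f0 lf]; have N0 := cochain_sqnorm_gt0 f0.
have := laplacian_dotl f f; rewrite lf cochain_dotZl cochain_dot_self => E.
rewrite -(@ler_pM2r _ (cochain_sqnorm f)%:C) ?ltcR//.
(* With [N] the squared norm and [S] the dart sum, [E] reads [lambda * N = N - S], so
   [(lambda - 1) * N = - S]. *)
have -> : `|lambda - 1| * (cochain_sqnorm f)%:C = `|\sum_e (dart_weight e)%:C *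
    cvdot (P e *m f (ini e)) (f (ter e))|.
  rewrite -[(cochain_sqnorm f)%:C in LHS]ger0_norm ?ler0c ?(ltW N0)// -normrM mulrBl.
  by rewrite E mul1r addrC addKr normrN.
rewrite -real_complexM; apply: dart_sum_le => // e.
apply: le_trans (cvdot_mulmx_le _ _ _) _.
by rewrite lecR ler_wpM2r// mulr_ge0 ?cvnorm_ge0.
Qed.

Lemma eigenvalue_Im_le lambda (M : R) : 0 <= M ->
    (forall e, opnorm ((P e)^t* - optrmat P e) <= M) ->
  is_eigenvalue (@laplacian R X P) lambda ->
  `|complex.Im lambda| <= 2^-1 * M.
Proof.
move=> M0 PM [f f0 lf]; have N0 := cochain_sqnorm_gt0 f0.
(* The second pairing is the conjugate of the first, so the left side becomes
   [lambda - Num.conj lambda] times the squared norm. *)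
have := laplacian_dotB f f; rewrite [cochain_dot f _]cochain_dotC lf.
rewrite cochain_dotZl cochain_dot_self.
have conj_sqnorm : Num.conj (cochain_sqnorm f)%:C = (cochain_sqnorm f)%:C.
  by apply: CrealP; apply/complex_realP; exists (cochain_sqnorm f).
rewrite rmorphM /= conj_sqnorm -mulrBl => E.
(* The factor 2 here is the source of the one half in the bound. *)
have Im_norm : `|lambda - Num.conj lambda| = (2 * `|complex.Im lambda|)%:C.
  rewrite (subcJ lambda : lambda - Num.conj lambda = _) !normrM.
  have -> : `|'i%C| = 1 :> R[i].
    by rewrite normc_def /= expr0n expr1n add0r sqrtr1.
  rewrite mulr1 real_complexM normr_nat; congr (_ * _).
    by rewrite rmorph_nat.
  by rewrite normc_def /= expr0n addr0 sqrtr_sqr.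
rewrite mulrC ler_pdivlMr ?ltr0n// mulrC -lecR -Im_norm.
rewrite -(@ler_pM2r _ (cochain_sqnorm f)%:C) ?ltcR//.
rewrite -{1}[(cochain_sqnorm f)%:C]ger0_norm ?ler0c ?(ltW N0)// -normrM E.
rewrite -real_complexM; apply: dart_sum_le => // e.
apply: le_trans (cvdot_mulmx_le _ _ _) _.
by rewrite lecR [cvnorm (f (ter e)) * _]mulrC ler_wpM2r// mulr_ge0 ?cvnorm_ge0.
Qed.

(** * Symmetric and unitary transmission systems *)

Lemma symmetric_self_adjoint :
  symmetric_transmission P -> self_adjoint (@laplacian R X P).
Proof.
move=> symP f g; apply/subr0_eq; rewrite laplacian_dotB big1// => e _.
by rewrite symP subrr mul0mx cvdotE big1 ?mulr0// => k _; rewrite mxE mul0r.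
Qed.

(** This is the case [M = 0] of [eigenvalue_Im_le], as symmetry makes every [(P e)^t* - optrmat P e]
    vanish. *)
Lemma symmetric_eigenvalue_real lambda : symmetric_transmission P ->
  is_eigenvalue (@laplacian R X P) lambda -> lambda \is Num.real.
Proof.
move=> symP /(eigenvalue_Im_le (lexx 0)); rewrite mulr0 normr_le0 => Im0.
have {}/Im0 : forall e, opnorm ((P e)^t* - optrmat P e) <= 0.
  move=> e; apply: opnorm_le => // u.
  by rewrite symP subrr mul0mx cvnorm0 mul0r.
by case: lambda => a b; rewrite complex_real.
Qed.

(** Symmetry and invertibility make the adjoint of [P e] a left inverse, so [P e] is an isometry.
    Equality can fail: on fibres of rank 0 the norm is 0. *)
Lemma unitary_opnorm_le1 e : strictly_unitary P -> opnorm (P e) <= 1.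
Proof.
move=> [symP invP]; apply: opnorm_le => // u; rewrite mul1r le_eqVlt.
apply/orP; left; apply/eqP; rewrite /cvnorm cvdot_adj mulmxA -symP.
by have [_ ->] := invP e; rewrite mul1mx.
Qed.

End Laplacian.

Theorem theorem1 (R : realType) (X : graph) (P : transmission R X)
    (deg_gt0 : forall v : vertex X, (0 < deg v)%N) :
  (forall lambda : R[i], is_eigenvalue (@laplacian R X P) lambda ->
     `|complex.Re lambda - 1|%:C <= `|lambda - 1|
       <= (\big[Num.max/0]_(e : dart X) opnorm (P e))%:C
     /\ complex.Im lambda <= 2^-1 *
          \big[Num.max/0]_(e : dart X) opnorm ((P e) ^t* - optrmat P e))
  /\ (symmetric_transmission P ->
        self_adjoint (@laplacian R X P)
        /\ forall lambda : R[i], is_eigenvalue (@laplacian R X P) lambda ->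
             lambda \is Num.real)
  /\ (strictly_unitary P ->
        forall lambda : R[i], is_eigenvalue (@laplacian R X P) lambda ->
          lambda \is Num.real /\ 0 <= lambda <= 2).
Proof.
split=> [lambda eig|].
  split; last first.
    apply: le_trans (ler_norm _) _; apply: eigenvalue_Im_le eig => //.
      (* The maximum starts at 0, which makes it nonnegative and, operator norms being nonnegative,
         does not enlarge it. *)
      exact: bigmax_ge_id.
    by move=> e; apply: le_bigmax.
  apply/andP; split.
    suff -> : complex.Re lambda - 1 = complex.Re (lambda - 1).
      exact: normc_ge_Re.
    by case: lambda {eig}.
  apply: eigenvalue_sub1_le eig => //; first exact: bigmax_ge_id.
  by move=> e; apply: le_bigmax.
split=> [symP|uniP lambda eig].
  split; first exact: symmetric_self_adjoint.
  by move=> lambda; apply: symmetric_eigenvalue_real.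
have lambda_real : lambda \is Num.real.
  by apply: symmetric_eigenvalue_real eig => //; case: uniP.
split=> //.
(* For real [lambda], the disc of radius 1 about 1 cuts out the interval from 0 to 2. *)
have := eigenvalue_sub1_le deg_gt0 ler01
  (fun e => unitary_opnorm_le1 e uniP) eig.
rewrite real_ler_norml ?rpredB ?rpred1// => /andP[lower upper].
apply/andP; split.
  by rewrite -(lerD2r (-1)) add0r.
by rewrite -(lerD2r (-1)) [2]mulr2n addrK.
Qed.
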